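(* Let $A_C\in\mathbb{R}^{n\times n}$ be a companion matrix with characteristic polynomial $N(s)$ and $n$ distinct eigenvalues $\lambda_1,\dots,\lambda_n$, and suppose the system $\dot x(t)=A_Cx(t)+e_nu(t)$ is stable (all $\lambda_i$ have negative real part). Let $x_0\in\mathbb{R}^n$ be a reachable state, let $P_C$ be the solution of $A_CP_C+P_CA_C^T=-e_ne_n^T$, and let $$\hat u(t)=e_n^Te^{-A_C^Tt}P_C^{-1}x_0=\sum_{i=1}^n\hat u_i(t),\qquad \hat u_i(t)=e_n^TR_i^*e^{-\lambda_i^*t}P_C^{-1}x_0,\qquad -\infty<t<0,$$ be the minimum energy control bringing the system from the zero state at $t=-\infty$ to $x_0$ at $t=0$, together with its modal components. Define $$\tilde P^C_i=\left\{-\frac{x_ix_i^T\mathcal{J}}{N'(\lambda_i)N(-\lambda_i)}\right\}_H,\qquad P^C_{ij}=\left\{\frac{-1}{\lambda_i+\lambda_j^*}\,\frac{x_ix_j^*}{N'(\lambda_i)N'(\lambda_j^* )}\right\}_H .$$ Then for all $i,j\in\{1,\dots,n\}$ $$x_0^T(P_C^{-1})^T\tilde P^C_iP_C^{-1}x_0=\frac12\int_{-\infty}^0\left(\hat u_i^*\hat u+\hat u^*\hat u_i\right)dt,$$ $$x_0^T(P_C^{-1})^TP^C_{ij}P_C^{-1}x_0=\frac12\int_{-\infty}^0\left(\hat u_i^*\hat u_j+\hat u_j^*\hat u_i\right)dt .$$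
   Context: The companion matrix is $A_C=\begin{bmatrix}0_{(n-1)\times 1}&I_{(n-1)\times(n-1)}\\-a_0&-a_1\ \cdots\ -a_{n-1}\end{bmatrix}$ with real $a_0,\dots,a_{n-1}$, so $N(s)=\det(sI-A_C)=\sum_{k=0}^na_ks^k$ with $a_n=1$; $e_n=[0,\dots,0,1]^T$. $x_i=[1,\lambda_i,\dots,\lambda_i^{n-1}]^T$; $\mathcal{J}=\mathrm{diag}(-1,(-1)^2,\dots,(-1)^n)$. $R_i$ is the residue of the resolvent $(sI-A_C)^{-1}=\sum_{i=1}^nR_i/(s-\lambda_i)$ at $\lambda_i$. $(\cdot)^*$ is the complex conjugate transpose (conjugate for scalars); $\{M\}_H=\tfrac12(M+M^* )$ is the Hermitian part. *)

(* Defs.v *)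
From HB Require Import structures.
From mathcomp Require Import all_boot all_order all_algebra.
From mathcomp Require Import spectral.
From mathcomp Require Import all_classical all_reals all_analysis.
From mathcomp Require Import complex.

Set Implicit Arguments.
Unset Strict Implicit.
Unset Printing Implicit Defensive.

Import Order.TTheory GRing.Theory Num.Theory.
Import numFieldNormedType.Exports.

Local Open Scope classical_set_scope.
Local Open Scope complex_scope.
Local Open Scope ring_scope.
Local Open Scope sesquilinear_scope.

(* Indices are shifted by one with respect to the usual 1-based convention:
   the k-th coordinate (k : 'I_n) is the (k+1)-st one on paper. *)

(* Same entries as mathcomp's [companionmx p], whose dimension is
   [(size p).-1] rather than a fixed [n]; here [a 0 k] is the coefficient
   of degree [k], the leading coefficient 1 being left implicit. *)
Definition companion (T : nzRingType) (n : nat) (a : 'rV[T]_n) : 'M[T]_n :=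
  \matrix_(i, j) if i.+1 == n then - a 0 j else (i.+1 == j :> nat)%:R.

Definition e_last (T : nzRingType) (n : nat) : 'cV[T]_n :=
  \col_i (i.+1 == n)%:R.

Definition cmx (R : realType) (m n : nat) (M : 'M[R]_(m, n)) :
    'M[R[i]]_(m, n) :=
  map_mx (fun x => x%:C) M.

Definition hermpart (C : numClosedFieldType) (n : nat) (M : 'M[C]_n) : 'M[C]_n :=
  2^-1 *: (M + M ^t*).

(* Entrywise sum of the exponential series. *)
Definition expmx (R : realType) (n : nat) (M : 'M[R]_n) : 'M[R]_n :=
  \matrix_(i, j) limn (series (fun k : nat => (M ^+ k) i j / k`!%:R)).

Definition cexp (R : realType) (z : R[i]) : R[i] :=
  (expR (complex.Re z) * cos (complex.Im z))
  +i* (expR (complex.Re z) * sin (complex.Im z)).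

Definition past (R : realType) : set R := `]-oo, 0[%classic.
Arguments past : clear implicits.

Definition cintegral_past (R : realType) (f : R -> R[i]) : R[i] :=
  (\int[lebesgue_measure]_(t in past R) complex.Re (f t))
  +i* (\int[lebesgue_measure]_(t in past R) complex.Im (f t)).

Section Control.
Context (R : realType) (n : nat) (A : 'M[R]_n) (b : 'cV[R]_n).

Definition energy (u : R -> R) : \bar R :=
  (\int[lebesgue_measure]_(t in past R) ((u t) ^+ 2)%:E)%E.

(* The finite-energy control [u] on ]-oo, 0[ brings x' = A x + b u from the
   zero state at -oo to [x0] at 0: the variation of constants formula
   x(0) = \int_(-oo)^0 e^(- A t) b u(t) dt, coordinate by coordinate. *)
Definition steers (u : R -> R) (x0 : 'cV[R]_n) : Prop :=
  [/\ measurable_fun (past R) u, (energy u < +oo)%E &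
      forall k : 'I_n, x0 k 0 =
        \int[lebesgue_measure]_(t in past R)
          ((expmx (- t *: A) *m b) k 0 * u t)].

Definition reachable (x0 : 'cV[R]_n) : Prop := exists u, steers u x0.

Definition min_energy_control (u : R -> R) (x0 : 'cV[R]_n) : Prop :=
  steers u x0 /\ forall v, steers v x0 -> (energy u <= energy v)%E.

End Control.

Section Modal.
Context (R : realType) (n : nat).
Implicit Types (A P : 'M[R]_n) (lam : 'I_n -> R[i]).

(* Partial fraction expansion of the resolvent; as the poles are simple and
   distinct, it determines the residues uniquely. *)
Definition resolvent_residues A lam (Res : 'I_n -> 'M[R[i]]_n) : Prop :=
  forall s : R[i], (forall i, s != lam i) ->
    invmx (s%:M - cmx A) = \sum_i (s - lam i)^-1 *: Res i.

Definition uhat A P (x0 : 'cV[R]_n) (t : R) : R :=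
  ((e_last R n)^T *m expmx (- t *: A^T) *m invmx P *m x0) 0 0.

Definition uhat_mode lam (Res : 'I_n -> 'M[R[i]]_n) P (x0 : 'cV[R]_n)
    (i : 'I_n) (t : R) : R[i] :=
  ((e_last _ n)^T *m (cexp (- (lam i)^* * t%:C) *: (Res i) ^t*)
     *m cmx (invmx P) *m cmx x0) 0 0.

Definition vdm_col lam (i : 'I_n) : 'cV[R[i]]_n := \col_k (lam i) ^+ k.

(* diag(-1, (-1)^2, ..., (-1)^n) *)
Definition sign_diag : 'M[R[i]]_n := diag_mx (\row_k (-1) ^+ k.+1).

Definition Ptilde (N : {poly R[i]}) lam (i : 'I_n) : 'M[R[i]]_n :=
  hermpart (- ((N^`().[lam i] * N.[- lam i])^-1 *:
     (vdm_col lam i *m (vdm_col lam i)^T *m sign_diag))).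

Definition Ppair (N : {poly R[i]}) lam (i j : 'I_n) : 'M[R[i]]_n :=
  hermpart ((-1 / (lam i + (lam j)^*)) *:
    ((N^`().[lam i] * N^`().[(lam j)^*])^-1 *:
     (vdm_col lam i *m (vdm_col lam j) ^t*))).

End Modal.

(* Main.v *)
Require Import Defs.
From HB Require Import structures.
From mathcomp Require Import all_boot all_order all_algebra.
From mathcomp Require Import spectral.
From mathcomp Require Import all_classical all_reals all_analysis.
From mathcomp Require Import measurable_realfun.
From mathcomp Require Import complex ring lra.

Set Implicit Arguments.
Unset Strict Implicit.
Unset Printing Implicit Defensive.

Import Order.TTheory GRing.Theory Num.Theory.
Import numFieldNormedType.Exports.

Local Open Scope classical_set_scope.
Local Open Scope complex_scope.
Local Open Scope ring_scope.

(** Write [x(s) = (1, s, ..., s^(n-1))^T] and [d_i = x(lam_i) / N'(lam_i)]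
    ([modal_vec]).  As [(s I - A) x(s) = N(s) e_n], comparing poles gives
    [R_i e_n = d_i] ([residue_last]) and hence the partial fraction expansion
    [\sum_i d_i / (s - lam_i) = x(s) / N(s)] ([modal_expansion]).  The [d_i] are
    eigenvectors of [A] with sum [e_n], so
    [e^(-A t) e_n = \sum_i e^(-lam_i t) d_i] ([expmx_e_last]).  With
    [q = P^-1 x0] and [c_i = d_i^T q] ([modal_coef]) the control is
    [u(t) = \sum_i c_i e^(-lam_i t)], and its [i]-th modal component is the
    conjugate of the [i]-th summand ([mode]).  Every integral then reduces to
    [\int_(-oo)^0 c e^(-mu t) dt = - c / mu] for [Re mu < 0] ([has_cint_cexp]).

    The Gramian of [e^(-A t) e_n] is therefore
    [- \sum_(i, j) d_i d_j^T / (lam_i + lam_j)].  This matrix solves the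
    Lyapunov equation, whose solution is unique because no [lam_i + lam_j]
    vanishes, so it is [P] ([cmx_lyapunov], [gramian_phi]); controllability
    makes it invertible ([modal_gramian_unit]).  A combination of the
    coordinates of [e^(-A t) e_n] that steers to [x0] has the same inner product
    with every control that steers to [x0], its own energy, and is thus the
    cheapest of them ([min_energy_gramian]).

    For the two quadratic forms: [q^T P_ij q] is the real part of
    [- c_i \bar c_j / (lam_i + \bar lam_j)], the integral of [\bar u_i u_j].  In
    [Ptilde_i] the sign matrix turns [x(lam_i)^T] into [- x(-lam_i)^T], so the
    factor [x(-lam_i)^T q / N(-lam_i)] is the partial fraction expansion at
    [s = - lam_i]; this gives the real part of
    [- \sum_j c_i c_j / (lam_i + lam_j)], the integral of [\bar u_i u]. *)

(** * The complex exponential *)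

Lemma cexpE (R : realType) (z : R[i]) :
  cexp z = (expR (complex.Re z))%:C *
           ((cos (complex.Im z)) +i* (sin (complex.Im z))).
Proof. by rewrite /cexp; simpc. Qed.

Lemma cexpD (R : realType) (z w : R[i]) : cexp (z + w) = cexp z * cexp w.
Proof.
case: z w => [a b] [c d]; rewrite /cexp; simpc => /=.
by rewrite expRD cosD sinD; congr (_ +i* _); ring.
Qed.

Lemma cexp_conj (R : realType) (z : R[i]) : cexp (z^*) = (cexp z)^*.
Proof. by case: z => [a b]; rewrite /cexp /= cosN sinN mulrN. Qed.

Lemma normc_cexp (R : realType) (z : R[i]) :
  `|cexp z| = (expR (complex.Re z))%:C.
Proof.
rewrite cexpE normrM normc_def /= expr0n addr0 sqrtr_sqr.
by rewrite ger0_norm ?expR_ge0// normc_def /= cos2Dsin2 sqrtr1 mulr1.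
Qed.

Lemma ReM_real (R : realType) (z : R[i]) (x : R) :
  complex.Re (z * x%:C) = complex.Re z * x.
Proof. by case: z => [a b] /=; rewrite mulr0 subr0. Qed.

Lemma complex_ReD (R : realType) (z w : R[i]) :
  complex.Re (z + w) = complex.Re z + complex.Re w.
Proof. by case: z w => [? ?] []. Qed.

Lemma complex_ImD (R : realType) (z w : R[i]) :
  complex.Im (z + w) = complex.Im z + complex.Im w.
Proof. by case: z w => [? ?] []. Qed.

Lemma normr_Re_le (R : realType) (z : R[i]) :
  `|complex.Re z| <= complex.Re `|z|.
Proof. by have := normc_ge_Re z; rewrite lecE /= => /andP[]. Qed.

(** Only real parts are differentiated: with an arbitrary complex factor [c]
    they also cover the imaginary part, as [Im w = Re (- i w)], and the real
    calculus applies. *)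
Lemma is_derive_Re_cexp (R : realType) (c z : R[i]) (t : R) :
  is_derive t 1 (fun s : R => complex.Re (c * cexp (z * s%:C)))
    (complex.Re (c * z * cexp (z * t%:C))).
Proof.
case: c z => [c1 c2] [a b].
have -> : (fun s : R => complex.Re ((c1 +i* c2) * cexp ((a +i* b) * s%:C))) =
  (fun s => expR (a * s) * (c1 * cos (b * s) - c2 * sin (b * s))).
  apply/funext => s; rewrite /cexp; simpc => /=.
  by rewrite ?(mulr0, add0r, subr0, addr0); ring.
have dl k : is_derive t 1 (fun s : R => k * s) k.
  by apply: is_derive_eq; rewrite /GRing.scale /= mulr1.
have dE : is_derive t 1 (fun s : R => expR (a * s)) (expR (a * t) * a).
  exact: (is_derive1_comp (is_derive_expR (a * t)) (dl a)).
have dC : is_derive t 1 (fun s : R => cos (b * s)) (- sin (b * t) * b).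
  exact: (is_derive1_comp (is_derive_cos (b * t)) (dl b)).
have dS : is_derive t 1 (fun s : R => sin (b * s)) (cos (b * t) * b).
  exact: (is_derive1_comp (is_derive_sin (b * t)) (dl b)).
apply: is_derive_eq.
rewrite /GRing.scale /cexp /=; simpc => /=; rewrite ?(mulr0, add0r, subr0, addr0).
ring.
Qed.

Lemma is_derive_exp_sum (R : realType) (a : nat -> R) (n : nat) (t : R) :
  is_derive t 1 (fun s : R => \sum_(k < n.+1) a k / k`!%:R * s ^+ k)
    (\sum_(k < n) a k.+1 / k`!%:R * t ^+ k).
Proof.
pose p := \poly_(k < n.+1) (a k / k`!%:R).
have pE : (fun s : R => \sum_(k < n.+1) a k / k`!%:R * s ^+ k) = horner p.
  by apply/funext => s; rewrite horner_poly.
have p'E : p^`() = \poly_(k < n) (a k.+1 / k`!%:R).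
  apply/polyP => k; rewrite coef_deriv !coef_poly ltnS.
  case: ifP => _; last by rewrite mul0rn.
  rewrite factS natrM -[LHS]mulr_natr.
  have n1 : k.+1%:R != 0 :> R by rewrite pnatr_eq0.
  have nf : k`!%:R != 0 :> R by rewrite pnatr_eq0 -lt0n fact_gt0.
  by rewrite invfM [k.+1%:R^-1 * _]mulrC mulrA divfK.
have -> : \sum_(k < n) a k.+1 / k`!%:R * t ^+ k = p^`().[t].
  by rewrite p'E horner_poly.
by rewrite pE; exact: is_derive_poly.
Qed.

Lemma le_of_le_derive (R : realType) (f g df dg : R -> R) :
  (forall t : R, is_derive t 1 f (df t)) ->
  (forall t : R, is_derive t 1 g (dg t)) ->
  (forall t : R, 0 <= t <= 1 -> df t <= dg t) -> f 0 <= g 0 ->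
  forall t : R, 0 <= t <= 1 -> f t <= g t.
Proof.
move=> Df Dg dfg fg0 t /andP[t0 t1].
have Dh (s : R) : is_derive s 1 (g \- f) (dg s - df s) by exact: is_deriveB.
have hle : (g \- f) 0 <= (g \- f) t.
  apply: (@ger0_derive1_le_cc _ _ 0 1) => //.
  - move=> x; rewrite in_itv /= => /andP[x0 x1].
    rewrite derive1E; have [_ ->] := Dh x.
    by rewrite subr_ge0 dfg// !ltW.
  - apply: continuous_subspaceT => x; apply: differentiable_continuous.
    by apply/derivable1_diffP; have [] := Dh x.
  - by rewrite in_itv /= lexx ler01.
  - by rewrite in_itv /= t0.
by move: hle => /=; rewrite -subr_ge0 -[f t <= _]subr_ge0; move: fg0; lra.
Qed.

(** The derivative of the remainder of order [n + 1] for [c] is the remainder of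
    order [n] for [c z]; the bound follows by integrating from 0.  The factor
    [expR `|Re z|] bounds [`|cexp (z t)|] on the unit interval. *)
Lemma cexp_taylor_bound (R : realType) (z : R[i]) (n : nat) (c : R[i]) (t : R) :
  0 <= t <= 1 ->
  `|complex.Re (c * cexp (z * t%:C)) -
     \sum_(k < n) complex.Re (c * z ^+ k) / k`!%:R * t ^+ k| <=
  expR `|complex.Re z| * complex.Re `|c * z ^+ n| / n`!%:R * t ^+ n.
Proof.
elim: n c t => [|n IH] c t t01.
  rewrite big_ord0 subr0 fact0 divr1 !expr0 !mulr1.
  apply: (le_trans (normr_Re_le _)).
  rewrite normrM normc_cexp ReM_real [leRHS]mulrC ler_wpM2l//.
    by rewrite normc_def sqrtr_ge0.
  rewrite ler_expR ReM_real.
  case/andP: t01 => t0 t1.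
  rewrite (le_trans (ler_norm _))// normrM (ger0_norm t0).
  by rewrite -[leRHS]mulr1 ler_wpM2l.
pose K := expR `|complex.Re z| * complex.Re `|c * z ^+ n.+1|.
pose r (s : R) := complex.Re (c * cexp (z * s%:C)) -
     \sum_(k < n.+1) complex.Re (c * z ^+ k) / k`!%:R * s ^+ k.
pose r' (s : R) := complex.Re (c * z * cexp (z * s%:C)) -
     \sum_(k < n) complex.Re (c * z * z ^+ k) / k`!%:R * s ^+ k.
pose B (s : R) := K / n.+1`!%:R * s ^+ n.+1.
pose B' (s : R) := K / n`!%:R * s ^+ n.
have Dr (s : R) : is_derive s 1 r (r' s).
  apply: is_deriveB; first exact: is_derive_Re_cexp.
  have := is_derive_exp_sum (fun k => complex.Re (c * z ^+ k)) n s.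
  by under [X in is_derive _ _ _ X]eq_bigr do rewrite exprS mulrA.
have DB (s : R) : is_derive s 1 B (B' s).
  have := is_derive_exp_sum (fun k => if k == n.+1 then K else 0) n.+1 s.
  rewrite [X in is_derive _ _ _ X](_ : _ = B' s); last first.
    rewrite big_ord_recr /= eqxx big1 ?add0r// => i _.
    by rewrite eqSS ltn_eqF// !mul0r.
  congr is_derive; apply/funext => u.
  rewrite big_ord_recr /= eqxx big1 ?add0r// => i _.
  by rewrite ltn_eqF// !mul0r.
have B0 : B 0 = 0 by rewrite /B expr0n mulr0.
have r0 : r 0 = 0.
  rewrite /r big_ord_recl big1 => [|i _]; last by rewrite expr0n mulr0.
  rewrite fact0 divr1 !expr0 !mulr1 mulr0 /cexp /= expR0 cos0 sin0 mulr1 mulr0.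
  by rewrite -[_ +i* _]/(1 : R[i]) mulr1 addr0 subrr.
have r'B s : 0 <= s <= 1 -> `|r' s| <= B' s.
  by move=> s01; rewrite (le_trans (IH _ _ s01))// /B' /K exprS mulrA.
rewrite ler_norml; apply/andP; split.
  apply: (@le_of_le_derive _ (fun s => - B s) r (fun s => - B' s) r') => //.
  - by move=> s /r'B; rewrite ler_norml => /andP[].
  - by rewrite B0 r0 oppr0.
apply: (@le_of_le_derive _ r B r' B') => //.
- by move=> s /r'B; rewrite ler_norml => /andP[].
- by rewrite B0 r0.
Qed.

(** The Taylor remainder at time 1 is at most a constant times
    [`|z|^n / n!]. *)
Lemma cvg_series_cexp (R : realType) (c z : R[i]) :
  series (fun k : nat => complex.Re (c * z ^+ k) / k`!%:R) @ \oo -->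
    complex.Re (c * cexp z).
Proof.
apply/cvgrPdist_le => /= e e0.
pose x := complex.Re `|z|.
pose K := expR `|complex.Re z| * complex.Re `|c|.
have xE : `|z| = x%:C by rewrite /x normc_def.
have /cvgrPdist_le : K * exp_coeff x n @[n --> \oo] --> 0.
  by rewrite -[X in _ --> X](mulr0 K); apply: cvgMr; exact: cvg_exp_coeff.
move=> /(_ e e0); apply: filterS => n /=; rewrite sub0r normrN => Hn.
have t1 : 0 <= (1 : R) <= 1 by rewrite ler01 lexx.
have := cexp_taylor_bound z n c t1.
rewrite mulr1 expr1n mulr1 => b.
have -> : series (fun k : nat => complex.Re (c * z ^+ k) / k`!%:R) n =
   \sum_(k < n) complex.Re (c * z ^+ k) / k`!%:R * 1 ^+ k.
  by rewrite /series /= big_mkord; under [RHS]eq_bigr do rewrite expr1n mulr1.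
have nE : complex.Re `|c * z ^+ n| = complex.Re `|c| * x ^+ n.
  by rewrite normrM normrX xE -rmorphXn ReM_real.
apply: (le_trans b); apply: le_trans (ler_norm _) _; apply: le_trans Hn.
by rewrite nE /K /exp_coeff /= !mulrA.
Qed.

(** * Integrals of exponentials over the past *)

Section PastIntegral.
Context {R : realType}.
Notation mu := (@lebesgue_measure R).
Implicit Types (f g F : R -> R) (v w : R).

(** Integrability is part of the notion, so that values add up. *)
Definition has_rint f v : Prop :=
  mu.-integrable (past R) (EFin \o f) /\ \int[mu]_(t in past R) f t = v.

Lemma measurable_past : measurable (past R).
Proof. exact: measurable_itv. Qed.
#[local] Hint Resolve measurable_past : core.

Lemma eq_has_rint f g v : (forall t, f t = g t) -> has_rint f v -> has_rint g v.
Proof. by move=> /funext ->. Qed.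

Lemma has_rintD f g v w :
  has_rint f v -> has_rint g w -> has_rint (fun t => f t + g t) (v + w).
Proof.
move=> [fi <-] [gi <-]; split; last exact: RintegralD.
have -> : EFin \o (fun t => f t + g t) = ((EFin \o f) \+ (EFin \o g))%E.
  by apply/funext => t.
exact: integrableD.
Qed.

Lemma has_rintZ k f v : has_rint f v -> has_rint (fun t => k * f t) (k * v).
Proof.
move=> [fi <-]; split; last exact: RintegralZl.
have -> : EFin \o (fun t => k * f t) = (fun t => k%:E * (EFin \o f) t)%E.
  by apply/funext => t.
exact: integrableZl.
Qed.

Lemma has_rint0 : has_rint (fun=> 0) 0.
Proof.
split; first exact: integrable0.
by rewrite /Rintegral integral0.
Qed.

Lemma has_rint_sum n (f : 'I_n -> R -> R) (v : 'I_n -> R) :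
  (forall i, has_rint (f i) (v i)) ->
  has_rint (fun t => \sum_i f i t) (\sum_i v i).
Proof.
move=> fv; elim: n => [|n IH] in f v fv *.
  rewrite big_ord0; apply: eq_has_rint has_rint0 => t.
  by rewrite big_ord0.
rewrite big_ord_recr /=; apply: eq_has_rint (has_rintD (IH _ _ _) (fv ord_max)).
  by move=> t; rewrite big_ord_recr.
by move=> i; apply: fv.
Qed.

Lemma ge0_has_rint_FTC f F : (forall t, 0 <= f t) -> continuous f ->
  (forall t : R, is_derive t 1 F (f t)) -> F t @[t --> -oo] --> 0 ->
  has_rint f (F 0).
Proof.
move=> f0 cf dF F0.
have mf : measurable_fun (past R) f.
  apply: measurable_funTS.
  exact: continuous_measurable_fun.
have cF : continuous F.
  move=> x; apply: differentiable_continuous.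
  by apply/derivable1_diffP; have [] := dF x.
have fE : (\int[mu]_(t in past R) (f t)%:E = (F 0)%:E)%E.
  rewrite /past integral_itv_bndo_bndc; last exact/measurable_EFinP.
  (* The substitution [t := - t] moves the integral to [`[0, +oo[]. *)
  rewrite -[X in `]-oo, X]]oppr0 ge0_integration_by_substitutionNy//; last first.
    exact: continuous_subspaceT.
  rewrite (@ge0_continuous_FTC2y _ _ (fun t => - F (- t)) _ 0) //.
  - by rewrite oppr0 sub0e -EFinN opprK.
  - by move=> x _ /=; exact: f0.
  - apply: continuous_subspaceT => x.
    by apply: continuous_comp; [exact: opp_continuous|exact: cf].
  - rewrite -oppr0; apply: cvgN.
    exact: (cvgNy_compNP F (nbhs 0)).1.
  - apply: cvg_at_right_filter; apply: cvgN.
    by apply: continuous_comp; [exact: opp_continuous|exact: cF].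
  - move=> x _; rewrite derive1E.
    have [_ ->] := is_deriveN (is_derive1_comp (dF (- x)) (is_deriveNid x 1)).
    by rewrite mulrN1 opprK.
split; last by rewrite /Rintegral fE.
apply/integrableP; split; first exact/measurable_EFinP.
under eq_integral do rewrite /= ger0_norm//.
by rewrite fE ltry.
Qed.

Lemma cvg_expR_Ny (al : R) : 0 < al -> expR (al * t) @[t --> -oo] --> 0.
Proof.
move=> al0; apply/cvgNy_compNP.
have -> : (fun t : R => expR (al * t)) \o -%R =
    (fun t => expR (- t)) \o (fun t => al * t).
  by apply/funext => t /=; rewrite mulrN.
have aly : al * t @[t --> +oo] --> +oo by apply: gt0_cvgMry.
exact: (cvg_comp _ _ aly (@cvgr_expR R)).
Qed.

(** The integrand oscillates, whereas the fundamental theorem on an unbounded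
    interval is used for nonnegative functions: adding the dominating
    exponential [g = `|c| e^(al t)], [al = - Re mu0], makes it nonnegative, and
    the integral of [g] is then subtracted. *)
Lemma has_rint_cexp (c mu0 : R[i]) : complex.Re mu0 < 0 ->
  has_rint (fun t => complex.Re (c * cexp (- mu0 * t%:C)))
    (complex.Re (- c / mu0)).
Proof.
move=> mu_lt0.
have mu_neq0 : mu0 != 0 by apply: contraTneq mu_lt0 => ->; rewrite ltxx.
pose al := - complex.Re mu0; have al0 : 0 < al by rewrite oppr_gt0.
pose f (t : R) := complex.Re (c * cexp (- mu0 * t%:C)).
pose F (t : R) := complex.Re (- c / mu0 * cexp (- mu0 * t%:C)).
pose K := complex.Re `|c|.
have bound (d : R[i]) (t : R) : `|complex.Re (d * cexp (- mu0 * t%:C))| <=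
    complex.Re `|d| * expR (al * t).
  apply: le_trans (normr_Re_le _) _.
  rewrite normrM normc_cexp !ReM_real.
  by have ReN (z : R[i]) : complex.Re (- z) = - complex.Re z; [case: z|rewrite ReN].
pose g (t : R) := K * expR (al * t); pose G (t : R) := K / al * expR (al * t).
have dF (t : R) : is_derive t 1 F (f t).
  have := is_derive_Re_cexp (- c / mu0) (- mu0) t.
  by rewrite mulrN divfK// opprK.
have dl (t : R) : is_derive t 1 (fun s : R => al * s) al.
  by apply: is_derive_eq; rewrite /GRing.scale /= mulr1.
have dexp (k t : R) :
    is_derive t 1 (fun s : R => k * expR (al * s)) (k * al * expR (al * t)).
  have dE := is_derive1_comp (is_derive_expR (al * t)) (dl t).
  have : is_derive t 1 (k \*: (expR \o (fun s : R => al * s)))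
      (k *: (expR (al * t) * al)) by exact: is_deriveZ.
  by rewrite /GRing.scale /= [expR _ * al]mulrC mulrA.
have dG (t : R) : is_derive t 1 G (g t).
  by have := dexp (K / al) t; rewrite divfK ?gt_eqF.
have cvgG : G t @[t --> -oo] --> 0.
  by rewrite -[X in _ --> X](mulr0 (K / al)); apply: cvgMr; exact: cvg_expR_Ny.
have cvgF : F t @[t --> -oo] --> 0.
  pose H (t : R) := complex.Re `|- c / mu0| * expR (al * t).
  have cvgH : H t @[t --> -oo] --> 0.
    rewrite -[X in _ --> X](mulr0 (complex.Re `|- c / mu0|)).
    by apply: cvgMr; exact: cvg_expR_Ny.
  apply: (@squeeze_cvgr _ _ _ _ (fun t => - H t) H) => //.
    by apply: nearW => t; rewrite -ler_norml; exact: bound.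
  by rewrite -oppr0; exact: cvgN.
have cont h dh : (forall t : R, is_derive t 1 h (dh t)) -> continuous (h : R -> R).
  move=> dh' x; apply: differentiable_continuous.
  by apply/derivable1_diffP; have [] := dh' x.
have cf : continuous f by apply: cont => t; exact: is_derive_Re_cexp.
have cg : continuous g by apply: cont => t; exact: dexp.
have hg : has_rint g (G 0).
  apply: ge0_has_rint_FTC => // t.
  by rewrite /g mulr_ge0 ?expR_ge0// /K normc_def sqrtr_ge0.
have hfg : has_rint (f \+ g) ((F \+ G) 0).
  apply: ge0_has_rint_FTC => //.
  - by move=> t /=; have := bound c t; rewrite -/(f t) -/K -/(g t) ler_norml; lra.
  - by move=> t; apply: continuousD; [exact: cf|exact: cg].
  - by rewrite -[X in _ --> X](addr0 0); apply: cvgD.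
have := has_rintD hfg (has_rintZ (-1) hg).
have -> : (F \+ G) 0 + -1 * G 0 = complex.Re (- c / mu0).
  rewrite /= mulN1r addrK /F mulr0 /cexp /= expR0 cos0 sin0 mulr1 mulr0.
  by rewrite -[_ +i* _]/(1 : R[i]) mulr1.
by apply: eq_has_rint => t /=; rewrite mulN1r addrK.
Qed.

End PastIntegral.

Section ComplexPastIntegral.
Context {R : realType}.
Implicit Types (f g : R -> R[i]) (v w c : R[i]).

Definition has_cint f v : Prop :=
  has_rint (fun t => complex.Re (f t)) (complex.Re v) /\
  has_rint (fun t => complex.Im (f t)) (complex.Im v).

Lemma has_cintE f v : has_cint f v -> cintegral_past f = v.
Proof. by case: v => a b [[_ fa] [_ fb]]; rewrite /cintegral_past fa fb. Qed.

Lemma eq_has_cint f g v : (forall t, f t = g t) -> has_cint f v -> has_cint g v.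
Proof. by move=> /funext ->. Qed.

Lemma has_cintD f g v w :
  has_cint f v -> has_cint g w -> has_cint (fun t => f t + g t) (v + w).
Proof.
move=> [fr fi] [gr gi]; split; rewrite ?complex_ReD ?complex_ImD.
  by apply: eq_has_rint (has_rintD fr gr) => t; rewrite complex_ReD.
by apply: eq_has_rint (has_rintD fi gi) => t; rewrite complex_ImD.
Qed.

Lemma has_cint0 : has_cint (fun=> 0) 0.
Proof. by split; exact: has_rint0. Qed.

Lemma has_cint_sum n (f : 'I_n -> R -> R[i]) (v : 'I_n -> R[i]) :
  (forall i, has_cint (f i) (v i)) ->
  has_cint (fun t => \sum_i f i t) (\sum_i v i).
Proof.
move=> fv; elim: n => [|n IH] in f v fv *.
  by rewrite big_ord0; apply: eq_has_cint has_cint0 => t; rewrite big_ord0.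
rewrite big_ord_recr /=; apply: eq_has_cint (has_cintD (IH _ _ _) (fv ord_max)).
  by move=> t; rewrite big_ord_recr.
by move=> i; apply: fv.
Qed.

Lemma has_cint_conj f v : has_cint f v -> has_cint (fun t => (f t)^*) v^*.
Proof.
have ReJ (x : R[i]) : complex.Re x^* = complex.Re x by case: x.
have ImJ (x : R[i]) : complex.Im x^* = - 1 * complex.Im x.
  by case: x => a b; rewrite mulN1r.
move=> [fr fi]; split; rewrite ?ReJ ?ImJ.
  by apply: eq_has_rint fr => t; rewrite ReJ.
by apply: eq_has_rint (has_rintZ (- 1) fi) => t; rewrite ImJ.
Qed.

Lemma has_cint_cexp c (mu0 : R[i]) : complex.Re mu0 < 0 ->
  has_cint (fun t => c * cexp (- mu0 * t%:C)) (- c / mu0).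
Proof.
move=> mu_lt0; split; first exact: has_rint_cexp.
have ImE (x : R[i]) : complex.Im x = - 1 * complex.Re ('i%C * x).
  by rewrite ['i%C * x]mulrC ReiNIm mulN1r opprK.
have := has_rintZ (- 1) (has_rint_cexp ('i%C * c) mu_lt0).
rewrite ImE -mulrN -mulrA; apply: eq_has_rint => t.
by rewrite ImE mulrA.
Qed.

Lemma has_cint_real (f : R -> R) v :
  has_cint (fun t => (f t)%:C) v -> has_rint f (complex.Re v).
Proof. by case. Qed.

End ComplexPastIntegral.

(** * Companion matrices, residues and the Lyapunov equation *)

Lemma char_poly_castmx (T : comNzRingType) (m n : nat) (e : m = n) (M : 'M[T]_m) :
  char_poly (castmx (e, e) M) = char_poly M.
Proof. by case: n / e; rewrite castmx_id. Qed.

(** [companionmx p] has dimension [(size p).-1], hence the cast. *)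
Lemma char_poly_companion (T : comNzRingType) (n : nat) (b : 'rV[T]_n) :
  char_poly (companion b) = 'X^n + rVpoly b.
Proof.
pose p := 'X^n + rVpoly b.
have szb : (size (rVpoly b) < size ('X^n : {poly T}))%N.
  by rewrite size_polyXn ltnS size_poly.
have e : (size p).-1 = n by rewrite size_polyDl// size_polyXn.
have pm : p \is monic by rewrite monicE lead_coefDl// lead_coefXn.
rewrite -[RHS](companionmxK pm) -(char_poly_castmx e); congr char_poly.
apply/matrixP => i j; rewrite castmxE !mxE /= coefD coefXn.
have n_gt0 : (0 < n)%N by exact: leq_ltn_trans (ltn_ord i).
rewrite e (ltn_eqF (ltn_ord j)) add0r.
by rewrite coef_rVpoly_ord -[i == n.-1 :> nat]eqSS (prednK n_gt0).
Qed.

Section CompanionAlgebra.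
Context {F : numFieldType} {n : nat} (b : 'rV[F]_n).
Let A := companion b.
Let N := char_poly A.

Definition vdm (s : F) : 'cV[F]_n := \col_k s ^+ k.

(** All rows but the last of [A] shift the powers of [s]; the last one produces
    the characteristic polynomial. *)
Lemma companion_vdm (s : F) : (s%:M - A) *m vdm s = N.[s] *: e_last F n.
Proof.
apply/colP => i.
have -> : N.[s] = s ^+ n + \sum_(k < n) b 0 k * s ^+ k.
  rewrite /N char_poly_companion hornerD hornerXn.
  rewrite (horner_coef_wide _ (size_poly _ _)).
  by congr (_ + _); apply: eq_bigr => k _; rewrite coef_rVpoly_ord.
rewrite mulmxBl mul_scalar_mx !mxE -exprS.
case: eqP => [in_|/eqP in_]; last first.
  have in_lt : (i.+1 < n)%N by rewrite ltn_neqAle in_ /=.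
  rewrite mulr0 (bigD1 (Ordinal in_lt)) //= big1 ?addr0.
    by rewrite !mxE (negbTE in_) eqxx mul1r subrr.
  move=> j; rewrite -val_eqE /= => ij.
  by rewrite !mxE (negbTE in_) eq_sym (negbTE ij) mul0r.
rewrite mulr1 {1}in_ -sumrN; congr (_ + _); apply: eq_bigr => j _.
by rewrite !mxE in_ eqxx mulNr opprK.
Qed.

Variable lam : 'I_n -> F.
Hypothesis lam_inj : injective lam.
Hypothesis lam_eigen : forall i, eigenvalue A (lam i).

Lemma char_poly_prod : N = \prod_i ('X - (lam i)%:P).
Proof.
pose rs := codom lam.
have -> : \prod_i ('X - (lam i)%:P) = \prod_(z <- rs) ('X - z%:P).
  by rewrite /rs /codom big_image.
have szrs : size rs = n by rewrite size_codom card_ord.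
have szN : size N = (size rs).+1 by rewrite size_char_poly szrs.
have rsN : all (root N) rs.
  by apply/allP => z /codomP [i ->]; rewrite -eigenvalue_root_char.
have urs : uniq_roots rs by rewrite uniq_rootsE; apply/injectiveP.
rewrite (all_roots_prod_XsubC szN rsN urs).
by rewrite (monicP (char_poly_monic A)) scale1r.
Qed.

Lemma char_poly_eq0 (s : F) : (N.[s] == 0) = (s \in codom lam).
Proof.
rewrite char_poly_prod horner_prod; apply/prodf_eq0/codomP => [[i _]|[i ->]].
  by rewrite hornerXsubC subr_eq0 => /eqP ->; exists i.
by exists i => //; rewrite hornerXsubC subrr.
Qed.

Lemma char_poly_deriv (i : 'I_n) :
  N^`().[lam i] = \prod_(j | j != i) (lam i - lam j).
Proof.
rewrite char_poly_prod (bigD1 i) //= derivM hornerD !hornerM derivXsubC.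
rewrite hornerXsubC subrr mul0r addr0 hornerC mul1r horner_prod.
by apply: eq_bigr => j _; rewrite hornerXsubC.
Qed.

Lemma char_poly_deriv_neq0 (i : 'I_n) : N^`().[lam i] != 0.
Proof.
rewrite char_poly_deriv; apply/prodf_neq0 => j ji.
by rewrite subr_eq0; apply: contra ji => /eqP /lam_inj ->.
Qed.

Lemma companion_vdm_eigen (i : 'I_n) : A *m vdm (lam i) = lam i *: vdm (lam i).
Proof.
have := companion_vdm (lam i).
have /eqP -> : N.[lam i] == 0 by rewrite char_poly_eq0 codom_f.
by rewrite scale0r mulmxBl mul_scalar_mx => /eqP; rewrite subr_eq0 => /eqP.
Qed.

Lemma resolvent_unit (s : F) : s \notin codom lam -> s%:M - A \in unitmx.
Proof.
rewrite -char_poly_eq0 -[_ == 0]/(root N s) -eigenvalue_root_char negbK kermx_eq0.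
by rewrite row_free_unit -opprB -scaleN1r unitmxZ ?unitrN1.
Qed.

(** The product of [p - q] with the characteristic polynomial vanishes
    everywhere, and a field of characteristic 0 is infinite. *)
Lemma eq_poly_horner (p q : {poly F}) :
  (forall s, s \notin codom lam -> p.[s] = q.[s]) -> p = q.
Proof.
move=> pq; pose r := (p - q) * N.
have r0 s : r.[s] = 0.
  rewrite hornerM hornerD hornerN; have [sl|sl] := boolP (s \in codom lam).
    by move: sl; rewrite -char_poly_eq0 => /eqP ->; rewrite mulr0.
  by rewrite pq// subrr mul0r.
have : r = 0.
  apply/eqP; apply: contraT => r_neq0.
  pose rs := [seq k%:R : F | k <- iota 0 (size r)].
  have := max_poly_roots r_neq0 (rs := rs).
  rewrite size_map size_iota ltnn; apply.
    by apply/allP => s _; apply/rootP.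
  by rewrite map_inj_uniq ?iota_uniq// => k l /eqP; rewrite eqr_nat => /eqP.
move/eqP; rewrite mulf_eq0 (negbTE (monic_neq0 (char_poly_monic A))) orbF.
by rewrite subr_eq0 => /eqP.
Qed.

Variable Res : 'I_n -> 'M[F]_n.
Hypothesis ResP : forall s, (forall i, s != lam i) ->
  invmx (s%:M - A) = \sum_i (s - lam i)^-1 *: Res i.

Definition modal_vec (i : 'I_n) : 'cV[F]_n := (N^`().[lam i])^-1 *: vdm (lam i).

Lemma notin_lam s : s \notin codom lam -> forall i, s != lam i.
Proof. by move=> sl i; apply: contra sl => /eqP ->; exact: codom_f. Qed.

Lemma residue_expansion (s : F) : s \notin codom lam ->
  \sum_i (s - lam i)^-1 *: (Res i *m e_last F n) = (N.[s])^-1 *: vdm s.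
Proof.
move=> sl; have Ns : N.[s] != 0 by rewrite char_poly_eq0.
have -> : (N.[s])^-1 *: vdm s = invmx (s%:M - A) *m e_last F n.
  apply: (canLR (scalerK Ns)); rewrite scalemxAr -companion_vdm.
  by rewrite mulKmx// resolvent_unit.
rewrite ResP; last exact: notin_lam.
by rewrite mulmx_suml; apply: eq_bigr => i _; rewrite scalemxAl.
Qed.

(** Clearing denominators in [residue_expansion] gives an identity between
    polynomials, which is evaluated at the pole [lam i]. *)
Lemma residue_last (i : 'I_n) : Res i *m e_last F n = modal_vec i.
Proof.
apply/colP => k.
pose P j := \prod_(l | l != j) ('X - (lam l)%:P).
have PE : \sum_j (Res j *m e_last F n) k 0 *: P j = 'X^k.
  apply: eq_poly_horner => s sl.
  have Ns : N.[s] != 0 by rewrite char_poly_eq0.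
  have := congr1 (fun v : 'cV[F]_n => N.[s] * v k 0) (residue_expansion sl).
  rewrite !mxE mulVKf// hornerXn => <-.
  rewrite summxE mulr_sumr horner_sum; apply: eq_bigr => j _.
  rewrite hornerZ !mxE mulrA mulrC; congr (_ * _).
  have sj : s - lam j != 0 by rewrite subr_eq0 notin_lam.
  by rewrite char_poly_prod (bigD1 j)//= hornerM hornerXsubC mulrAC mulfV// mul1r.
have := congr1 (horner^~ (lam i)) PE.
rewrite hornerXn horner_sum (bigD1 i)//= big1 ?addr0; last first.
  move=> j ji; rewrite hornerZ horner_prod (bigD1 i) 1?eq_sym//=.
  by rewrite hornerXsubC subrr mul0r mulr0.
rewrite hornerZ; have -> : (P i).[lam i] = N^`().[lam i].
  by rewrite char_poly_deriv horner_prod; apply: eq_bigr => j _; rewrite hornerXsubC.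
by rewrite !mxE => <-; rewrite mulrC mulfK// char_poly_deriv_neq0.
Qed.

Lemma modal_expansion (s : F) : s \notin codom lam ->
  \sum_i (s - lam i)^-1 *: modal_vec i = (N.[s])^-1 *: vdm s.
Proof.
by move=> /residue_expansion <-; apply: eq_bigr => i _; rewrite residue_last.
Qed.

Lemma modal_vec_eigen (i : 'I_n) : A *m modal_vec i = lam i *: modal_vec i.
Proof. by rewrite -scalemxAr companion_vdm_eigen !scalerA mulrC. Qed.

(** Multiply [modal_expansion] by [s - A]: each summand becomes [modal_vec i]
    because it is an eigenvector. *)
Lemma sum_modal_vec (s : F) : s \notin codom lam ->
  \sum_i modal_vec i = e_last F n.
Proof.
move=> sl; have Ns : N.[s] != 0 by rewrite char_poly_eq0.
have := congr1 (mulmx (s%:M - A)) (modal_expansion sl).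
rewrite -scalemxAr companion_vdm scalerA mulVf// scale1r => <-.
rewrite mulmx_sumr; apply: eq_bigr => i _.
rewrite -scalemxAr mulmxBl mul_scalar_mx modal_vec_eigen -scalerBl scalerA.
by rewrite mulVf ?scale1r// subr_eq0 notin_lam.
Qed.

Lemma Vandermonde_unit : Vandermonde n (\row_i lam i) \in unitmx.
Proof.
rewrite unitmxE det_Vandermonde unitfE.
apply/prodf_neq0 => i _; apply/prodf_neq0 => j ij.
rewrite !mxE subr_eq0; apply: contraTneq ij => /lam_inj ->.
by rewrite ltnn.
Qed.

Lemma modal_vec_row_eq0 (v : 'cV[F]_n) :
  (forall i, (modal_vec i)^T *m v = 0) -> v = 0.
Proof.
move=> h; pose W := (Vandermonde n (\row_i lam i))^T.
have Wu : W \in unitmx by rewrite unitmx_tr Vandermonde_unit.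
have Wv : W *m v = 0.
  apply/colP => i; have /eqP := h i.
  rewrite linearZ -scalemxAl scaler_eq0 invr_eq0 (negbTE (char_poly_deriv_neq0 i)).
  move=> /eqP /(congr1 (fun M : 'M[F]_1 => M 0 0)).
  by rewrite !mxE => {2}<-; apply: eq_bigr => k _; rewrite !mxE.
by rewrite -(mulKmx Wu v) Wv mulmx0.
Qed.

Hypothesis lam_add_neq0 : forall i j, lam i + lam j != 0.

(** In the eigenbasis the equation reads [(lam i + lam j) E i j = 0]. *)
Lemma lyapunov_homogeneous (D : 'M[F]_n) : A *m D + D *m A^T = 0 -> D = 0.
Proof.
move=> AD; pose V := Vandermonde n (\row_i lam i); pose L := diag_mx (\row_i lam i).
have Vu : V \in unitmx := Vandermonde_unit.
have AV : A *m V = V *m L.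
  apply/matrixP => k i.
  have /colP /(_ k) := companion_vdm_eigen i.
  rewrite mul_mx_diag !mxE mulrC => <-.
  by apply: eq_bigr => l _; rewrite !mxE.
pose U := invmx V.
have UA : U *m A = L *m U.
  by rewrite -[L](mulKmx Vu) -AV !mulmxA mulmxK.
pose E := U *m D *m U^T.
have LE : L *m E + E *m L = 0.
  have AU : A^T *m U^T = U^T *m L.
    by rewrite -trmx_mul UA trmx_mul tr_diag_mx.
  rewrite /E !mulmxA -UA -[_ *m L]mulmxA -AU !mulmxA -mulmxDl.
  by rewrite -!(mulmxA U) -mulmxDr AD mulmx0 mul0mx.
have E0 : E = 0.
  move: {AD} E LE => E LE; apply/matrixP => i j; have /matrixP /(_ i j) := LE.
  rewrite mul_diag_mx mul_mx_diag !mxE [E i j * _]mulrC -mulrDl => /eqP.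
  by rewrite mulf_eq0 (negbTE (lam_add_neq0 i j)) => /eqP.
have : V *m E *m V^T = 0 by rewrite E0 mulmx0 mul0mx.
by rewrite /E !mulmxA mulmxV// mul1mx -mulmxA -trmx_mul mulmxV// trmx1 mulmx1.
Qed.

(** For complex [lam_i] in the left half-plane, the integral over the past of
    [v(t) v(t)^T] with [v(t) = \sum_i e^(-lam_i t) d_i], term by term. *)
Definition modal_gramian : 'M[F]_n :=
  - \sum_i \sum_j (lam i + lam j)^-1 *: (modal_vec i *m (modal_vec j)^T).

Hypothesis lam_neq0 : forall i, lam i != 0.

Lemma sum_modal_vec0 : \sum_i modal_vec i = e_last F n.
Proof.
apply: (@sum_modal_vec 0); apply/codomP => -[i /eqP].
by rewrite eq_sym (negbTE (lam_neq0 i)).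
Qed.

Lemma modal_gramian_lyapunov :
  A *m modal_gramian + modal_gramian *m A^T = - (e_last F n *m (e_last F n)^T).
Proof.
rewrite mulmxN mulNmx -opprD; congr (- _).
rewrite -sum_modal_vec0 [(\sum_i modal_vec i)^T]linear_sum.
rewrite mulmx_sumr !mulmx_suml -big_split /=.
apply: eq_bigr => i _; rewrite !mulmx_sumr mulmx_suml -big_split /=.
apply: eq_bigr => j _.
move: (modal_vec_eigen i) (modal_vec_eigen j).
move: (modal_vec i) (modal_vec j) => v w Av Aw.
rewrite -scalemxAr -[X in _ + X]scalemxAl -scalerDr mulmxA Av.
rewrite -mulmxA -trmx_mul Aw linearZ /= -scalemxAl -scalemxAr -scalerDl.
by rewrite scalerA mulVf// scale1r.
Qed.

Lemma lyapunov_solution (P : 'M[F]_n) :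
  A *m P + P *m A^T = - (e_last F n *m (e_last F n)^T) -> P = modal_gramian.
Proof.
move=> AP; apply/eqP; rewrite -subr_eq0; apply/eqP/lyapunov_homogeneous.
by rewrite mulmxBr mulmxBl addrACA -opprD AP modal_gramian_lyapunov subrr.
Qed.

Lemma modal_gramian_sym : modal_gramian^T = modal_gramian.
Proof.
rewrite linearN linear_sum /=; congr (- _).
under eq_bigr do rewrite linear_sum /=.
rewrite exchange_big /=; apply: eq_bigr => i _; apply: eq_bigr => j _.
by rewrite linearZ /= trmx_mul trmxK addrC.
Qed.

(** Both sides of the Lyapunov equation are evaluated at [q]: first as a
    quadratic form, where the left-hand side vanishes by symmetry, then as a
    linear map. *)
Lemma modal_gramian_ker (q : 'cV[F]_n) : modal_gramian *m q = 0 ->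
  (e_last F n)^T *m q = 0 /\ modal_gramian *m (A^T *m q) = 0.
Proof.
set P := modal_gramian => Pq; set e := e_last F n.
have qP : q^T *m P = 0 by rewrite -[P]modal_gramian_sym -trmx_mul Pq trmx0.
have eq0 : e^T *m q = 0.
  have : q^T *m (A *m P + P *m A^T) *m q = 0.
    rewrite mulmxDr mulmxDl !mulmxA qP !mul0mx addr0.
    by rewrite -!mulmxA Pq !mulmx0.
  rewrite modal_gramian_lyapunov -/e mulmxN mulNmx => /eqP; rewrite oppr_eq0.
  rewrite !mulmxA -[q^T *m e]trmxK trmx_mul trmxK -mulmxA => /eqP.
  rewrite [e^T *m q]mx11_scalar tr_scalar_mx -scalar_mxM.
  move=> /(congr1 (fun M : 'M[F]_1 => M 0 0)); rewrite !mxE eqxx mulr1n => /eqP.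
  by rewrite mulf_eq0 orbb => /eqP ->; rewrite raddf0.
split=> //; have := congr1 (mulmx^~ q) modal_gramian_lyapunov.
by rewrite /= -/e -/P mulmxDl [in RHS]mulNmx -!mulmxA Pq eq0 !mulmx0 add0r oppr0.
Qed.

(** The kernel is invariant under [A^T] and orthogonal to [e_n], so each of its
    vectors [q] satisfies [e_n^T (A^T)^k q = 0] for all [k].  These numbers are
    the power sums [\sum_i lam_i^k d_i^T q], and the Vandermonde matrix is
    invertible. *)
Lemma modal_gramian_unit : modal_gramian \in unitmx.
Proof.
rewrite -row_free_unit; apply: inj_row_free => v vP.
apply: (can_inj (@trmxK _ _ _)); rewrite trmx0.
have {vP} : modal_gramian *m v^T = 0.
  by rewrite -modal_gramian_sym -trmx_mul vP trmx0.
move: (v^T) => q Pq.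
pose c := \row_i ((modal_vec i)^T *m q) 0 0.
have Ak k (w : 'cV[F]_n) : modal_gramian *m w = 0 ->
    \sum_i lam i ^+ k * ((modal_vec i)^T *m w) 0 0 = 0.
  elim: k w => [|k IH] w Pw; have [ew PAw] := modal_gramian_ker Pw.
    under eq_bigr do rewrite expr0 mul1r.
    by rewrite -summxE -mulmx_suml -linear_sum sum_modal_vec0 ew mxE.
  rewrite -[RHS](IH _ PAw); apply: eq_bigr => i _.
  move: (modal_vec_eigen i); move: (modal_vec i) => u Au.
  rewrite mulmxA -trmx_mul Au linearZ /= -scalemxAl exprSr -mulrA.
  by congr (_ * _); rewrite [RHS]mxE.
have Vc : Vandermonde n (\row_i lam i) *m c^T = 0.
  apply/colP => k; rewrite [RHS]mxE -(Ak k q Pq) mxE.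
  by apply: eq_bigr => i _; rewrite !mxE.
apply: modal_vec_row_eq0 => i.
have c0 : c^T = 0 by rewrite -(mulKmx Vandermonde_unit c^T) Vc mulmx0.
apply/matrixP => x y; have /colP /(_ i) := c0.
by rewrite !ord1 !mxE.
Qed.

End CompanionAlgebra.

(** * Matrix exponentials and minimum energy controls *)

Section RealExponentialSums.
Context {R : realType}.

Lemma continuous_Re_cexp (c z : R[i]) :
  continuous (fun t : R => complex.Re (c * cexp (z * t%:C))).
Proof.
move=> x; apply: differentiable_continuous.
by apply/derivable1_diffP; have [] := is_derive_Re_cexp c z x.
Qed.

Lemma Re_sum n (f : 'I_n -> R[i]) :
  complex.Re (\sum_i f i) = \sum_i complex.Re (f i).
Proof.
elim: n => [|n IH] in f *; first by rewrite !big_ord0.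
by rewrite !big_ord_recr /= -IH complex_ReD.
Qed.

Lemma cvg_series_Re_cexp n (c : R[i]) (d z : 'I_n -> R[i]) :
  series (fun k : nat => complex.Re (c * \sum_i d i * z i ^+ k) / k`!%:R) @ \oo -->
    complex.Re (c * \sum_i d i * cexp (z i)).
Proof.
elim: n => [|n IH] in d z *.
  rewrite big_ord0 mulr0.
  have -> : series (fun k : nat =>
      complex.Re (c * \sum_(i < 0) d i * z i ^+ k) / k`!%:R) = cst (0 : R).
    apply/funext => N; rewrite /series /= big1 // => k _.
    by rewrite big_ord0 mulr0 mul0r.
  exact: cvg_cst.
rewrite big_ord_recr /= mulrDr.
have -> : series (fun k : nat =>
      complex.Re (c * \sum_(i < n.+1) d i * z i ^+ k) / k`!%:R) =
    (fun N => series (fun k : nat => complex.Re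
      (c * \sum_(i < n) d (widen_ord (leqnSn n) i) *
                         z (widen_ord (leqnSn n) i) ^+ k) / k`!%:R) N +
     series (fun k => complex.Re (c * d ord_max * z ord_max ^+ k) / k`!%:R) N).
  apply/funext => N; rewrite /series /= -big_split /=; apply: eq_bigr => k _.
  by rewrite big_ord_recr /= mulrDr complex_ReD mulrDl mulrA.
rewrite complex_ReD mulrA; apply: cvgD; first exact: IH.
exact: cvg_series_cexp.
Qed.

(** A real sequence that is a complex sum of powers has a convergent exponential
    series; taking [c = 'i] in [cvg_series_Re_cexp] shows that the complex limit
    is real. *)
Lemma series_cexp_real n (d z : 'I_n -> R[i]) (s : nat -> R) :
  (forall k, (s k)%:C = \sum_i d i * z i ^+ k) ->
  (limn (series (fun k => s k / k`!%:R)))%:C = \sum_i d i * cexp (z i).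
Proof.
move=> sE; set S := \sum_i _.
have ReS : limn (series (fun k => s k / k`!%:R)) = complex.Re S.
  have -> : series (fun k => s k / k`!%:R) =
      series (fun k => complex.Re (1 * \sum_i d i * z i ^+ k) / k`!%:R).
    by congr series; apply/funext => k; rewrite -sE mul1r.
  by apply: cvg_lim => //; rewrite -[S]mul1r; exact: cvg_series_Re_cexp.
have ImS : complex.Im S = 0.
  have := @cvg_series_Re_cexp _ 'i%C d z; rewrite -/S ['i%C * S]mulrC ReiNIm => cS.
  apply: oppr_inj; rewrite oppr0 -(cvg_lim _ cS)//.
  apply: cvg_lim => //.
  have -> : series (fun k : nat =>
      complex.Re ('i%C * \sum_i d i * z i ^+ k) / k`!%:R) = cst (0 : R).
    apply/funext => N; rewrite /series /= big1 // => k _.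
    by rewrite -sE ['i%C * _]mulrC ReiNIm /= oppr0 mul0r.
  exact: cvg_cst.
by rewrite ReS; move: ImS; case: (S) => x y /= ->.
Qed.

End RealExponentialSums.

(** The state at time 0 caused by a unit impulse along [b] at time [t < 0]. *)
Definition impulse (R : realType) (n : nat) (A : 'M[R]_n) (b : 'cV[R]_n)
    (k : 'I_n) (t : R) : R :=
  (expmx (- t *: A) *m b) k 0.

Section MinimumEnergy.
Context {R : realType} {n : nat}.
Notation mu := (@lebesgue_measure R).
Variables (A : 'M[R]_n) (b : 'cV[R]_n) (P : 'M[R]_n) (q x0 : 'cV[R]_n).
Let phi := impulse A b.
Let u (t : R) : R := \sum_k q k 0 * phi k t.
Hypothesis mphi : forall k, measurable_fun (past R) (phi k).
Hypothesis gramian : forall k l, has_rint (fun t => phi k t * phi l t) (P k l).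
Hypothesis Pq : P *m q = x0.

Lemma has_rint_energy (v : R -> R) (E : R) :
  has_rint (fun t => v t ^+ 2) E -> energy v = E%:E.
Proof.
move=> [vi <-]; rewrite /energy /Rintegral fineK//.
by apply: (integrable_fin_num _ vi); exact: measurable_itv.
Qed.

Lemma energy_has_rint (v : R -> R) : measurable_fun (past R) v ->
  (energy v < +oo)%E -> has_rint (fun t => v t ^+ 2) (fine (energy v)).
Proof.
move=> mv ev; split => //; apply/integrableP; split.
  by apply/measurable_EFinP; exact: measurable_funX.
by under eq_integral do rewrite /= ger0_norm ?sqr_ge0//.
Qed.

(** Integrability comes from [2 `|p v| <= p^2 + v^2]. *)
Lemma has_rint_mul_energy (v : R -> R) (k : 'I_n) : measurable_fun (past R) v ->
  (energy v < +oo)%E ->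
  has_rint (fun t => phi k t * v t) (\int[mu]_(t in past R) (phi k t * v t)).
Proof.
move=> mv ev; split => //.
have [vi _] := has_rintD (gramian k k) (energy_has_rint mv ev).
apply: (le_integrable _ _ _ vi); first by rewrite /past; exact: measurable_itv.
  by apply/measurable_EFinP; apply: measurable_funM; [exact: mphi|exact: mv].
move=> t _; rewrite /= lee_fin [leRHS]ger0_norm; last first.
  by rewrite addr_ge0 ?sqr_ge0// -expr2 sqr_ge0.
rewrite ler_norml; apply/andP; split.
  by have := sqr_ge0 (phi k t + v t); nra.
by have := sqr_ge0 (phi k t - v t); nra.
Qed.

(** Every admissible [v] satisfies [\int u v = q^T x0 = \int u^2], so
    [\int v^2 - \int u^2 = \int (v - u)^2 >= 0]. *)
Lemma min_energy_gramian : min_energy_control A b u x0.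
Proof.
have mu_ : measurable_fun (past R) u.
  by apply: measurable_sum => k; apply: measurable_funM.
pose E := \sum_k q k 0 * x0 k 0.
have pu k : has_rint (fun t => phi k t * u t) (x0 k 0).
  rewrite -Pq mxE; have := has_rint_sum (fun l => has_rintZ (q l 0) (gramian k l)).
  rewrite (eq_bigr (fun l => P k l * q l 0)) => [|l _]; last by rewrite mulrC.
  by apply: eq_has_rint => t; rewrite mulr_sumr; apply: eq_bigr => l _; rewrite mulrCA.
have uw w : (forall k, has_rint (fun t => phi k t * w t) (x0 k 0)) ->
    has_rint (fun t => u t * w t) E.
  move=> h; apply: eq_has_rint (has_rint_sum (fun k => has_rintZ (q k 0) (h k))) => t.
  by rewrite mulr_suml; apply: eq_bigr => k _; rewrite mulrA.
have uu : has_rint (fun t => u t ^+ 2) E by exact: uw.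
split.
  split => //; first by rewrite (has_rint_energy uu) ltry.
  by move=> k; have [_ <-] := pu k.
move=> v [mv ev vx].
have vv := energy_has_rint mv ev.
have uv : has_rint (fun t => u t * v t) E.
  by apply: uw => k; rewrite vx; exact: has_rint_mul_energy.
rewrite (has_rint_energy uu) (has_rint_energy vv) lee_fin.
have [_] := has_rintD (has_rintD vv (has_rintZ (- 2) uv)) uu.
move=> dE; suff : 0 <= fine (energy v) + -2 * E + E by lra.
rewrite -dE; apply: Rintegral_ge0 => t _.
by have := sqr_ge0 (v t - u t); nra.
Qed.

End MinimumEnergy.

(** * Modal decomposition of the control and its energy *)

Local Open Scope sesquilinear_scope.

Section ComplexMatrices.
Context {R : realType}.

Lemma cmxM m n p (M : 'M[R]_(m, n)) (M' : 'M[R]_(n, p)) :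
  cmx (M *m M') = cmx M *m cmx M'.
Proof. exact: (map_mxM (real_complex R)). Qed.

Lemma cmxD m n (M M' : 'M[R]_(m, n)) : cmx (M + M') = cmx M + cmx M'.
Proof. exact: (map_mxD (real_complex R)). Qed.

Lemma cmxN m n (M : 'M[R]_(m, n)) : cmx (- M) = - cmx M.
Proof. exact: (map_mxN (real_complex R)). Qed.

Lemma cmxZ m n (k : R) (M : 'M[R]_(m, n)) : cmx (k *: M) = k%:C *: cmx M.
Proof. exact: (map_mxZ (real_complex R)). Qed.

Lemma cmx_tr m n (M : 'M[R]_(m, n)) : cmx M^T = (cmx M)^T.
Proof. by rewrite /cmx -map_trmx. Qed.

Lemma conj_cmx m n (M : 'M[R]_(m, n)) : map_mx Num.conj (cmx M) = cmx M.
Proof. by apply/matrixP => i j; rewrite !mxE; exact: conjc_real. Qed.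

Lemma cmx_companion n (a : 'rV[R]_n) : cmx (companion a) = companion (cmx a).
Proof.
apply/matrixP => i j; rewrite !mxE; case: ifP => _; first by rewrite rmorphN.
by rewrite rmorph_nat.
Qed.

Lemma cmx_e_last n : cmx (e_last R n) = e_last _ n.
Proof. by apply/matrixP => i j; rewrite !mxE rmorph_nat. Qed.

Lemma char_poly_cmx_conj n (A : 'M[R]_n) (p := char_poly (cmx A)) (s : R[i]) :
  p^`().[s^*] = (p^`().[s])^*.
Proof.
have -> : p = map_poly (real_complex R) (char_poly A).
  by rewrite map_char_poly.
rewrite deriv_map -[RHS]horner_map /= -map_poly_comp.
by congr (_.[_]); apply: eq_map_poly => x; exact: (esym (conjc_real x)).
Qed.

Lemma expmx_tr n (M : 'M[R]_n) : expmx M^T = (expmx M)^T.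
Proof.
have MX k : M^T ^+ k = (M ^+ k)^T.
  elim: k => [|k IH]; first by rewrite !expr0 trmx1.
  by rewrite exprS IH exprSr [RHS]trmx_mul.
apply/matrixP => i j; rewrite !mxE; congr (limn (series _)).
by apply/funext => k; rewrite MX mxE.
Qed.

Lemma mulmx_e_last (T : nzRingType) m n (M : 'M[T]_(m, n)) (j : 'I_n) k :
  j.+1 = n -> (M *m e_last T n) k 0 = M k j.
Proof.
move=> jn; rewrite mxE (bigD1 j)//= big1 ?addr0.
  by rewrite mxE jn eqxx mulr1.
move=> l lj; rewrite mxE; case: eqP => [ln|_]; last by rewrite mulr0.
by case/eqP: lj; apply/val_inj/eq_add_S; rewrite ln.
Qed.

End ComplexMatrices.

Lemma conj_cexpM (R : realType) (c z : R[i]) (t : R) :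
  (c * cexp (- z * t%:C))^* = c^* * cexp (- z^* * t%:C).
Proof.
have -> : - z^* * t%:C = (- z * t%:C)^*.
  case: z => u v; apply/eqP; rewrite eq_complex.
  by apply/andP; split; apply/eqP => /=; ring.
by rewrite cexp_conj; exact: rmorphM.
Qed.

Section QuadraticForm.
Context {R : realType} {n : nat} (q : 'cV[R]_n).

Definition pairing (v : 'cV[R[i]]_n) : R[i] := (v^T *m cmx q) 0 0.

Definition qform (M : 'M[R[i]]_n) : R[i] := ((cmx q)^T *m M *m cmx q) 0 0.

Lemma pairing_sum (I : finType) (f : I -> 'cV[R[i]]_n) :
  pairing (\sum_i f i) = \sum_i pairing (f i).
Proof. by rewrite /pairing linear_sum mulmx_suml summxE. Qed.

Lemma pairingZ k v : pairing (k *: v) = k * pairing v.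
Proof. by rewrite /pairing linearZ -scalemxAl mxE. Qed.

Lemma qformZ k M : qform (k *: M) = k * qform M.
Proof. by rewrite /qform -scalemxAr -scalemxAl mxE. Qed.

Lemma qform_rank1 (v w : 'cV[R[i]]_n) :
  qform (v *m w^T) = pairing v * pairing w.
Proof.
rewrite /qform mulmxA -mulmxA mxE big_ord1; congr (_ * _).
by rewrite -[_ *m v]trmxK trmx_mul trmxK mxE.
Qed.

(** Holds because [q] is real. *)
Lemma qform_adj M : qform (M^t*) = (qform M)^*.
Proof.
have -> : (qform M)^* = (map_mx Num.conj ((cmx q)^T *m M *m cmx q)) 0 0.
  by rewrite mxE.
have tr0 (X : 'M[R[i]]_1) : X 0 0 = X^T 0 0 by rewrite mxE.
rewrite !map_mxM -[map_mx _ (cmx q)^T]map_trmx conj_cmx [RHS]tr0.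
by rewrite !trmx_mul trmxK mulmxA [(map_mx _ M)^T]map_trmx.
Qed.

Lemma qform_herm M : qform (hermpart M) = 2^-1 * (qform M + (qform M)^*).
Proof.
rewrite qformZ -qform_adj; congr (_ * _).
by rewrite /qform mulmxDr mulmxDl mxE.
Qed.

Lemma pairing_conj v : pairing (map_mx Num.conj v) = (pairing v)^*.
Proof.
have -> : (pairing v)^* = (map_mx Num.conj (v^T *m cmx q)) 0 0 by rewrite mxE.
by rewrite map_mxM conj_cmx -map_trmx.
Qed.

End QuadraticForm.

(** The numbers [c_i]: on all of the past, the control is
    [\sum_i c_i e^(-lam_i t)]. *)
Definition modal_coef (R : realType) (n : nat) (a : 'rV[R]_n)
    (lam : 'I_n -> R[i]) (q : 'cV[R]_n) (i : 'I_n) : R[i] :=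
  pairing q (modal_vec (cmx a) lam i).

Definition mode (R : realType) (n : nat) (a : 'rV[R]_n)
    (lam : 'I_n -> R[i]) (q : 'cV[R]_n) (i : 'I_n) (t : R) : R[i] :=
  modal_coef a lam q i * cexp (- lam i * t%:C).

Section ModalDecomposition.
Context {R : realType} {n : nat} (n_gt0 : (0 < n)%N).
Variables (a : 'rV[R]_n) (lam : 'I_n -> R[i]) (Res : 'I_n -> 'M[R[i]]_n).
Variables (P : 'M[R]_n) (x0 : 'cV[R]_n).
Hypothesis lam_inj : injective lam.
Hypothesis lam_eigen : forall i, eigenvalue (cmx (companion a)) (lam i).
Hypothesis stable : forall i, complex.Re (lam i) < 0.
Hypothesis ResP : resolvent_residues (companion a) lam Res.
Hypothesis lyapunov : companion a *m P + P *m (companion a)^T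
                      = - (e_last R n *m (e_last R n)^T).

Let A := companion a.
Let N : {poly R[i]} := char_poly (cmx A).
Let m := modal_vec (cmx a) lam.
Let q : 'cV[R]_n := invmx P *m x0.
Let c := modal_coef a lam q.
Let x := mode a lam q.
Let phi := impulse A (e_last R n).

Let eigenC i : eigenvalue (companion (cmx a)) (lam i).
Proof. by rewrite -cmx_companion. Qed.

Let ResC (s : R[i]) : (forall i, s != lam i) ->
  invmx (s%:M - companion (cmx a)) = \sum_i (s - lam i)^-1 *: Res i.
Proof. by rewrite -cmx_companion; exact: ResP. Qed.

Let Re_lt0_neq0 (z : R[i]) : complex.Re z < 0 -> z != 0.
Proof. by apply: contraTneq => ->; rewrite ltxx. Qed.

Let stable_add i j : complex.Re (lam i + lam j) < 0.
Proof. by rewrite complex_ReD; have := stable i; have := stable j; lra. Qed.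

Let stable_addJ i j : complex.Re (lam i + (lam j)^*) < 0.
Proof.
have -> : complex.Re (lam i + (lam j)^*) = complex.Re (lam i) + complex.Re (lam j).
  by rewrite complex_ReD; case: (lam j).
by have := stable i; have := stable j; lra.
Qed.

Let lam_neq0 i : lam i != 0 := Re_lt0_neq0 (stable i).
Let lam_add_neq0 i j : lam i + lam j != 0 := Re_lt0_neq0 (stable_add i j).

Let NE : N = char_poly (companion (cmx a)).
Proof. by rewrite /N cmx_companion. Qed.

Lemma cmx_lyapunov : cmx P = modal_gramian (cmx a) lam.
Proof.
apply: (lyapunov_solution lam_inj eigenC ResC) => //.
have := congr1 (@cmx R n n) lyapunov.
by rewrite cmxD cmxN !cmxM !cmx_tr cmx_companion cmx_e_last.
Qed.

Lemma gramian_unit : P \in unitmx.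
Proof.
rewrite -(map_unitmx (real_complex R)) -[map_mx _ P]/(cmx P) cmx_lyapunov.
exact: (modal_gramian_unit lam_inj eigenC ResC).
Qed.

(** Expanding [e_n] in eigenvectors turns the power [(- t A)^k e_n] into
    [\sum_i (- lam_i t)^k d_i], so the entries are sums of exponential
    series. *)
Lemma expmx_e_last (k : 'I_n) (t : R) :
  (phi k t)%:C = \sum_i m i k 0 * cexp (- lam i * t%:C).
Proof.
have jn : (n.-1 < n)%N by rewrite prednK.
have jS : (Ordinal jn).+1 = n by rewrite /= prednK.
rewrite /phi /impulse (mulmx_e_last _ _ jS) mxE; apply: series_cexp_real => r.
rewrite -(mulmx_e_last _ _ jS).
have -> : ((((- t *: A) ^+ r) *m e_last R n) k 0)%:C =
    cmx (((- t *: A) ^+ r) *m e_last R n) k 0 by rewrite [RHS]mxE.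
have -> : cmx (((- t *: A) ^+ r) *m e_last R n) =
    \sum_i (- lam i * t%:C) ^+ r *: m i.
  elim: r => [|r IH].
    rewrite mul1mx cmx_e_last -(sum_modal_vec0 lam_inj eigenC ResC lam_neq0).
    by apply: eq_bigr => i _; rewrite expr0 scale1r.
  have -> : (- t *: A) ^+ r.+1 = (- t *: A) *m (- t *: A) ^+ r by rewrite exprS.
  rewrite -mulmxA cmxM IH cmxZ cmx_companion mulmx_sumr.
  apply: eq_bigr => i _.
  have := modal_vec_eigen lam_inj eigenC i; rewrite -/(m i).
  move: (m i) => v Av; rewrite -scalemxAl -scalemxAr Av.
  by rewrite !scalerA exprSr; congr (_ *: _); rewrite rmorphN /=; ring.
by rewrite summxE; apply: eq_bigr => i _; rewrite mxE mulrC.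
Qed.

Lemma has_cint_modes i j :
  has_cint (fun t => x i t * x j t) (- (c i * c j) / (lam i + lam j)).
Proof.
apply: eq_has_cint (has_cint_cexp (c i * c j) (stable_add i j)) => t.
by rewrite /x /mode mulrACA -cexpD -mulrDl -opprD.
Qed.

Lemma has_cint_modesJ i j :
  has_cint (fun t => x i t * (x j t)^*)
    (- (c i * (c j)^*) / (lam i + (lam j)^*)).
Proof.
apply: eq_has_cint (has_cint_cexp (c i * (c j)^*) (stable_addJ i j)) => t.
by rewrite /x /mode conj_cexpM mulrACA -cexpD -mulrDl -opprD.
Qed.

Lemma gramian_phi k l : has_rint (fun t => phi k t * phi l t) (P k l).
Proof.
have -> : P k l = complex.Re (modal_gramian (cmx a) lam k l).
  by rewrite -cmx_lyapunov [cmx _ _ _]mxE.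
apply: has_cint_real.
have mode i j : has_cint
    (fun t => (m i k 0 * cexp (- lam i * t%:C)) * (m j l 0 * cexp (- lam j * t%:C)))
    (- (m i k 0 * m j l 0) / (lam i + lam j)).
  apply: eq_has_cint (has_cint_cexp (m i k 0 * m j l 0) (stable_add i j)) => t.
  by rewrite mulrACA -cexpD -mulrDl -opprD.
have := has_cint_sum (fun i => has_cint_sum (mode i)).
have -> : \sum_i \sum_j - (m i k 0 * m j l 0) / (lam i + lam j) =
    modal_gramian (cmx a) lam k l.
  rewrite mxE summxE -sumrN; apply: eq_bigr => i _.
  rewrite summxE -sumrN; apply: eq_bigr => j _.
  by rewrite [in RHS]mxE [in RHS]mxE big_ord1 [(_^T) 0 l]mxE mulNr mulrC.
apply: eq_has_cint => t; rewrite rmorphM /= !expmx_e_last mulr_suml.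
by apply: eq_bigr => i _; rewrite mulr_sumr.
Qed.

Lemma measurable_phi k : measurable_fun (past R) (phi k).
Proof.
apply: measurable_funTS.
have -> : phi k = fun t => \sum_i complex.Re (m i k 0 * cexp (- lam i * t%:C)).
  by apply/funext => t; rewrite -Re_sum -expmx_e_last.
apply: measurable_sum => i; apply: continuous_measurable_fun.
exact: continuous_Re_cexp.
Qed.

Lemma uhatE (t : R) : uhat A P x0 t = \sum_k q k 0 * phi k t.
Proof.
rewrite /uhat -!mulmxA -/q mulmxA.
have -> : (e_last R n)^T *m expmx (- t *: A^T) = (expmx (- t *: A) *m e_last R n)^T.
  by rewrite trmx_mul -expmx_tr linearZ.
by rewrite mxE; apply: eq_bigr => k _; rewrite mxE mulrC.
Qed.

Lemma uhat_min_energy : min_energy_control A (e_last R n) (uhat A P x0) x0.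
Proof.
have -> : uhat A P x0 = fun t => \sum_k q k 0 * phi k t.
  by apply/funext => t; exact: uhatE.
apply: min_energy_gramian measurable_phi gramian_phi _.
by rewrite /q mulKVmx// gramian_unit.
Qed.

Lemma uhat_modes (t : R) : (uhat A P x0 t)%:C = \sum_i x i t.
Proof.
rewrite uhatE rmorph_sum /=.
under eq_bigr do rewrite rmorphM /= expmx_e_last mulr_sumr.
rewrite exchange_big /=; apply: eq_bigr => i _.
rewrite /x /mode /modal_coef /pairing mxE mulr_suml; apply: eq_bigr => k _.
by rewrite !mxE mulrCA mulrA.
Qed.

(** Transposing, [e_n^T R_i^*] is the adjoint of [R_i e_n = d_i]. *)
Lemma uhat_modeE (i : 'I_n) (t : R) : uhat_mode lam Res P x0 i t = (x i t)^*.
Proof.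
rewrite /x /mode conj_cexpM.
rewrite /uhat_mode -!mulmxA -cmxM -/q -scalemxAl -scalemxAr mxE mulrC.
congr (_ * _); rewrite mulmxA.
have -> : (e_last _ n)^T *m (Res i)^t* = map_mx Num.conj (m i)^T.
  have <- : Res i *m e_last _ n = m i.
    exact: (residue_last lam_inj eigenC ResC).
  rewrite trmx_mul map_mxM; congr (_ *m _).
  by rewrite -cmx_e_last -map_trmx conj_cmx.
by rewrite -pairing_conj /pairing -map_trmx.
Qed.

Let pairing_vdm i : pairing q (vdm_col lam i) = N^`().[lam i] * c i.
Proof.
rewrite /c /modal_coef pairingZ mulrA NE mulfV ?mul1r//.
exact: char_poly_deriv_neq0.
Qed.

Let N'_neq0 i : N^`().[lam i] != 0.
Proof. by rewrite NE; exact: char_poly_deriv_neq0. Qed.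

(** [N] has real coefficients, so conjugation commutes with [N'], and the
    normalisations by [N'] turn the pairings with [x(lam_i)] and [x(lam_j)] into
    [c_i] and the conjugate of [c_j]. *)
Lemma qform_Ppair i j (S := - (c i * (c j)^*) / (lam i + (lam j)^*)) :
  qform q (Ppair N lam i j) = 2^-1 * (S + S^*).
Proof.
rewrite qform_herm; set Z := qform q _; suff -> : Z = S by [].
rewrite /Z !qformZ -map_trmx qform_rank1 pairing_conj !pairing_vdm.
rewrite char_poly_cmx_conj rmorphM /S.
have d0 : lam i + (lam j)^* != 0 := Re_lt0_neq0 (stable_addJ i j).
have Ni := N'_neq0 i; have Nj : (N^`().[lam j])^* != 0 by rewrite conjC_eq0.
by field; rewrite d0 Ni Nj.
Qed.

(** The row [x(lam_i)^T J] is [- x(-lam_i)^T], and [- lam_i] is not an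
    eigenvalue, so [modal_expansion] evaluates [x(-lam_i)^T q / N(-lam_i)]. *)
Lemma qform_Ptilde i (S := \sum_j - (c i * c j) / (lam i + lam j)) :
  qform q (Ptilde N lam i) = 2^-1 * (S + S^*).
Proof.
rewrite qform_herm; set Z := qform q _; suff -> : Z = S by [].
have nl : - lam i \notin codom lam.
  apply/codomP => -[j ij]; have := lam_add_neq0 i j.
  by rewrite -ij subrr eqxx.
have signE : pairing q ((vdm_col lam i)^T *m sign_diag R n)^T =
    - pairing q (vdm (- lam i)).
  rewrite /pairing trmxK mxE [X in - X]mxE -sumrN; apply: eq_bigr => k _.
  rewrite mul_mx_diag !mxE [(- lam i) ^+ k]exprNn exprS; ring.
rewrite /Z -scaleNr qformZ -mulmxA -[_ *m sign_diag R n]trmxK qform_rank1 signE.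
rewrite pairing_vdm.
have := congr1 (pairing q) (modal_expansion lam_inj eigenC ResC nl).
rewrite pairing_sum pairingZ -NE => E.
have NN : N.[- lam i] != 0 by rewrite NE (char_poly_eq0 lam_inj eigenC).
have -> : pairing q (vdm (- lam i)) =
    N.[- lam i] * \sum_j (- lam i - lam j)^-1 * c j.
  rewrite (eq_bigr (fun j => pairing q ((- lam i - lam j)^-1 *: m j))).
    by rewrite E mulVKf.
  by move=> j _; rewrite pairingZ.
have -> : S = c i * \sum_j (- lam i - lam j)^-1 * c j.
  rewrite mulr_sumr; apply: eq_bigr => j _.
  move: (c i) (c j) (lam i) (lam j) => ci cj li lj.
  by rewrite -opprD invrN !mulNr mulrN -mulrA [cj / _]mulrC.
have Ni := N'_neq0 i; move: (\sum_j _) => T.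
by field; rewrite Ni NN.
Qed.

End ModalDecomposition.

Theorem mainTheorem8 (R : realType) (n : nat) (n_gt0 : (0 < n)%N)
  (a : 'rV[R]_n) (lam : 'I_n -> R[i]) (Res : 'I_n -> 'M[R[i]]_n)
  (P : 'M[R]_n) (x0 : 'cV[R]_n)
  (lam_distinct : injective lam)
  (lam_eigen : forall i, eigenvalue (cmx (companion a)) (lam i))
  (stable : forall i, complex.Re (lam i) < 0)
  (ResP : resolvent_residues (companion a) lam Res)
  (lyapunov : companion a *m P + P *m (companion a)^T
              = - (e_last R n *m (e_last R n)^T))
  (x0_reachable : reachable (companion a) (e_last R n) x0) :
  let N : {poly R[i]} := char_poly (cmx (companion a)) in
  let u : R -> R := uhat (companion a) P x0 in
  let uC : R -> R[i] := fun t => (u t)%:C in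
  let um : 'I_n -> R -> R[i] := uhat_mode lam Res P x0 in
  let Q (M : 'M[R[i]]_n) : R[i] :=
    (cmx x0^T *m cmx (invmx P)^T *m M *m cmx (invmx P) *m cmx x0) 0 0 in
  [/\ min_energy_control (companion a) (e_last R n) u x0,
      (forall t : R, t < 0 -> uC t = \sum_i um i t),
      (forall i : 'I_n,
         Q (Ptilde N lam i) =
         2^-1 * cintegral_past (fun t => (um i t)^* * uC t + (uC t)^* * um i t))
    & (forall i j : 'I_n,
         Q (Ppair N lam i j) =
         2^-1 * cintegral_past
                  (fun t => (um i t)^* * um j t + (um j t)^* * um i t))].
Proof.
move=> N u uC um Q.
pose q := invmx P *m x0.
have umE i t : um i t = (mode a lam q i t)^*.
  exact: (uhat_modeE P x0 lam_distinct lam_eigen ResP).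
have uCE t : uC t = \sum_i mode a lam q i t.
  exact: (uhat_modes n_gt0 P x0 lam_distinct lam_eigen stable ResP).
have QE M : Q M = qform q M.
  by rewrite /Q /qform cmxM trmx_mul -!cmx_tr !mulmxA.
split.
- exact: (uhat_min_energy n_gt0 x0 lam_distinct lam_eigen stable ResP lyapunov).
  (* The control is real, hence equal to the sum of the conjugate modes. *)
- move=> t _; have -> : uC t = (uC t)^* by rewrite -[RHS]/(conjc _) conjc_real.
  by rewrite uCE rmorph_sum; apply: eq_bigr => i _; rewrite umE.
- move=> i; rewrite QE.
  rewrite (qform_Ptilde P x0 lam_distinct lam_eigen stable ResP).
  congr (_ * _); apply/esym/has_cintE.
  have ci := has_cint_sum (has_cint_modes a P x0 stable i).
  apply: eq_has_cint (has_cintD ci (has_cint_conj ci)) => t.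
  rewrite -mulr_sumr -uCE umE conjCK.
  by congr (_ + _); rewrite [RHS]mulrC; exact: rmorphM.
- move=> i j; rewrite QE.
  rewrite (qform_Ppair P x0 lam_distinct lam_eigen stable).
  congr (_ * _); apply/esym/has_cintE.
  have ci := has_cint_modesJ a P x0 stable i j.
  apply: eq_has_cint (has_cintD ci (has_cint_conj ci)) => t.
  rewrite !umE !conjCK; congr (_ + _).
  by rewrite -[in RHS](conjCK (mode a lam q j t)) [RHS]mulrC; exact: rmorphM.
Qed.
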